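(* Fix a time interval $(a,b)$. Let $A$ be a constant $n\times n$ real matrix. The system $\dot x=Ax$ is a cyclic variation diminishing differential system (CVDDS) on $(a,b)$ if and only if $A\in\mathbb{Q}^+$.
   Context: Here $\mathbb{Q}^+\subset\mathbb{R}^{n\times n}$ (not the rationals) denotes the set of $n\times n$ real matrices that are Metzler (every off-diagonal entry is nonnegative), irreducible (the associated directed adjacency graph is strongly connected), and can have non-zero entries only on the main diagonal, the super-diagonal, the sub-diagonal, and in entries $(1,n)$ and $(n,1)$. Sign variations. For a vector $y\in\mathbb{R}^m$ with no zero entries, $\sigma(y)$ is the number of indices $k\in\{1,\dots,m-1\}$ with $y_ky_{k+1}<0$. For any $y\in\mathbb{R}^m$: $s^-(y):=\sigma(\bar y)$, where $\bar y$ is obtained from $y$ by deleting all zero entries (and $s^-(0):=0$); $s^+(y):=\max_{z\in P(y)}\sigma(z)$, where $P(y)$ is the set of vectors obtained from $y$ by replacing each zero entry by either $1$ or $-1$. Cyclic sign variations. For $y\in\mathbb{R}^n$, $$s_c^-(y):=\max_{i\in\{1,\dots,n\}} s^-\big([y_i,\dots,y_n,y_1,\dots,y_i]'\big),\qquad s_c^+(y):=\max_{i\in\{1,\dots,n\}} s^+\big([y_i,\dots,y_n,y_1,\dots,y_i]'\big),$$ where each bracketed vector has $n+1$ entries (it goes once around the ring, beginning and ending with $y_i$), and where in the definition of $s_c^+$, if $y_i=0$, then both copies of $y_i$ (the first and the last entry) are replaced by the same value, either $1$ or $-1$. SCVDP. A matrix $B\in\mathbb{R}^{n\times n}$ satisfies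 the strong cyclic variation diminishing property (SCVDP) if $s_c^+(Bx)\le s_c^-(x)$ for all $x\in\mathbb{R}^n\setminus\{0\}$. CVDDS. For a linear system $\dot x(t)=A(t)x(t)$, let $\Phi(t,t_0)$ denote the transition matrix, i.e. the solution of $\frac{d}{dt}\Phi(t,t_0)=A(t)\Phi(t,t_0)$, $\Phi(t_0,t_0)=I$ (so that $\Phi(t,t_0)=\exp((t-t_0)A)$ if $A$ is constant). The system is called a cyclic variation diminishing differential system (CVDDS) on $(a,b)$ if $\Phi(t,t_0)$ satisfies the SCVDP for every pair $(t_0,t)$ with $a<t_0<t<b$. *)

(* Defs.v *)
From HB Require Import structures.
From mathcomp Require Import all_boot all_order all_algebra.
From mathcomp Require Import all_classical all_reals all_analysis.
Set Implicit Arguments.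
Unset Strict Implicit.
Unset Printing Implicit Defensive.
Import Order.TTheory GRing.Theory Num.Theory.
Import numFieldNormedType.Exports.
Local Open Scope ring_scope.

Definition metzler (R : realType) (n : nat) (A : 'M[R]_n) : Prop :=
  forall i j, i != j -> 0 <= A i j.

(* The graph on the n indices has an edge i -> j when A i j <> 0; [connect] is
   its reflexive transitive closure, so every 1 x 1 matrix is irreducible. *)
Definition irreducible_mx (R : realType) (n : nat) (A : 'M[R]_n) : Prop :=
  forall i j : 'I_n, connect [rel k l | A k l != 0] i j.

(* Indices start at 0, so the corners (1, n) and (n, 1) are (0, n.-1) and
   (n.-1, 0). *)
Definition cyclic_tridiagonal (R : realType) (n : nat) (A : 'M[R]_n) : Prop :=
  forall i j : 'I_n, A i j != 0 ->
    [\/ i = j,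
        (j = i.+1 :> nat) \/ (i = j.+1 :> nat),
        (i = 0 :> nat) /\ (j = n.-1 :> nat) |
        (i = n.-1 :> nat) /\ (j = 0 :> nat)].

Definition Qplus (R : realType) (n : nat) (A : 'M[R]_n) : Prop :=
  [/\ metzler A, irreducible_mx A & cyclic_tridiagonal A].

Definition sign_changes (R : realType) (y : seq R) : nat :=
  (\sum_(k < (size y).-1) (y`_k * y`_k.+1 < 0)%R)%N.

Definition s_minus (R : realType) (y : seq R) : nat :=
  sign_changes [seq z <- y | z != 0].

Definition fill_zeros (R : realType) (y : seq R) (e : seq bool) : seq R :=
  [seq (if p.1 == 0 then (-1) ^+ p.2 else p.1) | p : R * bool <- zip y e].

(* The set P(y) of all replacements of the zeros of y by 1 or -1, as a list. *)
Definition zero_fillings (R : realType) (y : seq R) : seq (seq R) :=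
  [seq fill_zeros y e | e : (size y).-tuple bool].

(* [y_i, ..., y_{n-1}, y_0, ..., y_i] (0-based), with size y + 1 entries. *)
Definition ring_from (R : realType) (y : seq R) (i : nat) : seq R :=
  drop i y ++ take i.+1 y.

Definition sc_minus (R : realType) (y : seq R) : nat :=
  \max_(i < size y) s_minus (ring_from y i).

(* Both end entries of [ring_from y i] are y_i. The condition on the fillings
   only matters when y_i = 0: both copies must get the same sign. *)
Definition sc_plus (R : realType) (y : seq R) : nat :=
  \max_(i < size y)
    \max_(z <- zero_fillings (ring_from y i) | head 0%R z == last 0%R z)
      sign_changes z.

Definition cv_seq (R : realType) (n : nat) (x : 'cV[R]_n) : seq R :=
  [seq x i 0 | i <- enum 'I_n].

Definition SCVDP (R : realType) (n : nat) (B : 'M[R]_n) : Prop :=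
  forall x : 'cV[R]_n, x != 0 ->
    (sc_plus (cv_seq (B *m x)) <= sc_minus (cv_seq x))%N.

Definition is_transition_matrix (R : realType) (n : nat) (a b : \bar R)
    (A : R -> 'M[R]_n) (Phi : R -> R -> 'M[R]_n) : Prop :=
  forall t0 : R, (a < t0%:E < b)%E ->
    Phi t0 t0 = 1%:M /\
    forall t : R, (a < t%:E < b)%E ->
      is_derive t (1 : R) (fun s => Phi s t0) (A t *m Phi t t0).

(* The transition matrix on (a, b) is unique when A is continuous. *)
Definition CVDDS (R : realType) (n : nat) (a b : \bar R)
    (A : R -> 'M[R]_n) : Prop :=
  exists Phi : R -> R -> 'M[R]_n,
    is_transition_matrix a b A Phi /\
    forall t0 t : R, (a < t0%:E)%E -> t0 < t -> (t%:E < b)%E ->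
      SCVDP (Phi t t0).

(* Main.v *)
Require Import Defs.
From HB Require Import structures.
From mathcomp Require Import all_boot all_order all_algebra.
From mathcomp Require Import all_classical all_reals all_analysis.
From mathcomp Require Import zify ring lra.
Set Implicit Arguments.
Unset Strict Implicit.
Unset Printing Implicit Defensive.
Import Order.TTheory GRing.Theory Num.Theory.
Import numFieldNormedType.Exports.
Local Open Scope ring_scope.

(** Let C(e) be the number of sign changes of a sign pattern e around the ring.
    Then s_c^+(y) and s_c^-(y) are the maximum and the minimum of C(e) over the
    patterns e compatible with y, i.e. equal to the sign of y_i where y_i <> 0.

    Sufficiency. Let x' = A x with A in Q^+ and x(t0) <> 0, and let e and e' be
    compatible with x(t0) and x(t). If t > t0 is close to t0, then
    C(e') <= C(e): the sign of x_i(t) is that of the first nonzero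
    (A^k x(t0))_i, and inside a run of zeros of x(t0) a block of one sign whose
    two neighbours have the other sign would only receive contributions of that
    other sign, hence would vanish to all orders, which irreducibility excludes;
    so e' changes at most once along the run. If t < t0 is close to t0, then
    C(e) <= C(e'): reversing time replaces A by -A, and multiplying coordinate i
    by (-1)^i, on the ring unrolled to a line, restores the sign of the
    off-diagonal entries and exchanges changes with non-changes. A real induction
    on the time combines both facts into s_c^+(x(t)) <= s_c^-(x(t0)).

    Necessity. The image of a basis vector must be of one strict sign, so the
    flow has positive entries; this gives the sign of the off-diagonal entries,
    and irreducibility because a closed set of indices would produce zero
    entries. If A_ij > 0 with i and j not adjacent, a vector with entry 0 at i,
    a large entry at j and -1 elsewhere has 2 cyclic changes, but 4 immediately
    afterwards. *)

(** * Sign changes along a run of zeros *)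

(* A function with derivatives c k at 0 can be nonnegative to the right of 0 only
   if c is nonnegative in this lexicographic sense. *)
Definition lex_nonneg (R : numDomainType) (c : nat -> R) : Prop :=
  forall k, (forall m, (m < k)%N -> c m = 0) -> 0 <= c k.

Lemma lex_nonnegZ (R : numDomainType) (a : R) (c : nat -> R) :
  0 <= a -> lex_nonneg c -> lex_nonneg (fun k => a * c k).
Proof.
move=> a0 hc k h; have [->|aN0] := eqVneq a 0; first by rewrite mul0r.
apply: mulr_ge0 => //; apply: hc => m /h /eqP.
by rewrite mulf_eq0 (negbTE aN0) => /eqP.
Qed.

(** By strong induction: once all lower orders vanish, both terms are nonnegative, so a zero sum
    makes both zero. *)
Lemma lex_nonneg_add0 (R : numDomainType) (c d : nat -> R) k :
  lex_nonneg c -> lex_nonneg d -> (forall m, (m < k)%N -> c m + d m = 0) ->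
  forall m, (m < k)%N -> c m = 0 /\ d m = 0.
Proof.
move=> hc hd h; elim/ltn_ind => m IH mk.
have cm : 0 <= c m by apply: hc => j jm; case: (IH j jm (ltn_trans jm mk)).
have dm : 0 <= d m by apply: hd => j jm; case: (IH j jm (ltn_trans jm mk)).
by have /eqP := h m mk; rewrite paddr_eq0 // => /andP[/eqP-> /eqP->].
Qed.

Lemma lex_nonnegD (R : numDomainType) (c d : nat -> R) :
  lex_nonneg c -> lex_nonneg d -> lex_nonneg (fun k => c k + d k).
Proof.
move=> hc hd k h; have z := lex_nonneg_add0 hc hd h.
by apply: addr_ge0; [apply: hc|apply: hd] => m /z[].
Qed.

(** In a pattern, [true] stands for a negative sign, through the factor [(-1) ^+ e i]. *)
Definition changes (e : nat -> bool) (a b : nat) : nat :=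
  (\sum_(a <= k < b) (e k (+) e k.+1))%N.

Lemma changes_cat e a m b : (a <= m)%N -> (m <= b)%N ->
  changes e a b = (changes e a m + changes e m b)%N.
Proof. by move=> am mb; rewrite /changes (big_cat_nat am mb). Qed.

Lemma odd_changes e a b : (a <= b)%N -> odd (changes e a b) = e a (+) e b.
Proof.
move=> /subnKC <-; elim: (b - a)%N => [|k IH].
  by rewrite addn0 /changes big_geq // addbb.
rewrite (@changes_cat _ _ (a + k)) ?leq_addr // ?addnS // oddD IH.
by rewrite /changes big_nat1 oddb addbA addbK.
Qed.

(** Between two consecutive changes the pattern is constant, which is what the hypothesis
    excludes. *)
Lemma changes_le1 e a b :
  (forall p q, (a <= p)%N -> (p < q)%N -> (q < b)%N ->
     e p != e p.+1 -> e q != e q.+1 ->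
     exists2 i, (p < i <= q)%N & e i != e p.+1) ->
  (changes e a b <= 1)%N.
Proof.
move=> H.
have [/existsP[p0 hp0]|] := boolP [exists p : 'I_b, (a <= p)%N && (e p != e p.+1)]; last first.
  rewrite negb_exists => /forallP h; rewrite /changes big_nat_cond big1 // => i.
  rewrite andbT => /andP[ai ib].
  by move: (h (Ordinal ib)); rewrite /= ai /= negbK => /eqP ->; rewrite addbb.
have ex : exists p, [&& (a <= p)%N, (p < b)%N & e p != e p.+1].
  by exists p0; case/andP: hp0 => -> ->; rewrite ltn_ord.
case: (ex_minnP ex) => p /and3P[ap pb hp] minp.
(* With no change strictly between [p] and [i], the pattern is constant on [p.+1..i], against
   [H]. *)
have nochange : forall i, (p < i)%N -> (i < b)%N -> e i = e i.+1.
  elim/ltn_ind => i IH pi ib; apply/eqP/negPn/negP => hi.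
  have [j /andP[pj ji]] := H p i ap pi ib hp hi.
  suff -> : e j = e p.+1 by rewrite eqxx.
  move: pj ji; rewrite -(subnKC (ltn0Sn p)) => {hi}.
  elim: j => // j IHj; rewrite ltnS leq_eqVlt => /orP[/eqP<-//|pj] ji.
  by rewrite -IHj ?(ltnW ji)//; apply/esym/IH => //; lia.
rewrite (@changes_cat _ _ p.+1) ?(ltnW (leqW ap))//; last by lia.
rewrite (@changes_cat _ _ p) // {1}/changes big_nat_cond big1 ?add0n; last first.
  move=> i; rewrite andbT => /andP[ai ip]; have := contraNN (minp i).
  have -> : ~~ (p <= i)%N by rewrite -ltnNge.
  by move=> /(_ isT); rewrite ai /= (ltn_trans ip pb) /= negbK => /eqP->; rewrite addbb.
rewrite {1}/changes big_nat1 /changes big_nat_cond big1 ?addn0 ?leq_b1 //.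
by move=> i; rewrite andbT => /andP[pi ib]; rewrite nochange // addbb.
Qed.

(** Cut [a..b] at the indices outside [Z]. The patterns agree at both ends of a run, so their
    numbers of changes there have the same parity, and a number at most 1 is the least of its
    parity. *)
Lemma changes_le_of_runs (e e' : nat -> bool) (Z : pred nat) a b :
  (a <= b)%N -> ~~ Z a -> ~~ Z b ->
  (forall i, (a <= i <= b)%N -> ~~ Z i -> e i = e' i) ->
  (forall l r, (a <= l)%N -> (l < r)%N -> (r <= b)%N -> ~~ Z l -> ~~ Z r ->
     (forall i, (l < i < r)%N -> Z i) -> (changes e' l r <= 1)%N) ->
  (changes e' a b <= changes e a b)%N.
Proof.
move=> + Za; elim/ltn_ind: b => b IH ab Zb ee H.
move: ab; rewrite leq_eqVlt => /orP[/eqP<-|ab].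
  by rewrite /changes !big_geq.
have ex : exists l, [&& (a <= l)%N, (l < b)%N & ~~ Z l] by exists a; rewrite leqnn ab.
have bnd l : [&& (a <= l)%N, (l < b)%N & ~~ Z l] -> (l <= b)%N.
  by case/and3P => _ /ltnW.
case: (ex_maxnP ex bnd) => l /and3P[al lb Zl] maxl.
rewrite (changes_cat e' al (ltnW lb)) (changes_cat e al (ltnW lb)).
apply: leq_add.
  apply: IH => // [i /andP[ai il]|l' r ? ? rl]; first by apply: ee; lia.
  by apply: H => //; lia.
have : (changes e' l b <= 1)%N.
  apply: H => // i /andP[li ib]; apply/negPn/negP => Zi.
  by have := maxl i; rewrite (leq_trans al (ltnW li)) ib Zi /= => /(_ isT); lia.
have : odd (changes e' l b) = odd (changes e l b).
  by rewrite !odd_changes ?(ltnW lb) // !ee // ?al ?(ltnW lb) ?leqnn ?(ltnW ab).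
by case: (changes e' l b) => [|[|]] //; case: (changes e l b).
Qed.

(* [lo..hi] is a run of zeros of the initial vector between two nonzero entries,
   on the ring unrolled to a line, and u k i is the k-th derivative at the initial
   time of coordinate i. *)
Section Run.
Variables (R : realFieldType) (u : nat -> nat -> R) (d alpha beta : nat -> R).
Variables (lo hi : nat).
Hypothesis alpha_ge0 : forall i, 0 <= alpha i.
Hypothesis beta_ge0 : forall i, 0 <= beta i.
Hypothesis uS : forall k i, (lo < i < hi)%N ->
  u k.+1 i = d i * u k i + alpha i * u k i.-1 + beta i * u k i.+1.
Hypothesis irr : forall l r, (lo <= l)%N -> (l.+1 < r)%N -> (r <= hi)%N ->
  alpha l.+1 != 0 \/ beta r.-1 != 0.
Hypothesis u0_lo : u 0 lo != 0.
Hypothesis u0_hi : u 0 hi != 0.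

(** Through the nonzero coupling given by [irr], a block vanishing to all orders would make an
    adjacent outside index vanish too, and so would grow until it contradicted [u0_lo] or [u0_hi].
    With at least two interior indices, the recurrence at an end one involves a single outside
    neighbour. *)
Lemma run_not_null l r : (lo <= l)%N -> (l.+2 < r)%N -> (r <= hi)%N ->
  ~ (forall k i, (l < i < r)%N -> u k i = 0).
Proof.
have [s] := ubnP ((l - lo) + (hi - r))%N.
elim: s l r => // s IH l r hs ll lr rh h.
have inner k i : (l < i < r)%N -> alpha i * u k i.-1 + beta i * u k i.+1 = 0.
  move=> hi'; have hi2 : (lo < i < hi)%N by lia.
  by have := uS k hi2; rewrite (h k.+1 i) // (h k i) // mulr0 add0r => <-.
case: (irr ll (ltnW lr) rh) => c0.
- have ul k : u k l = 0.
    have := inner k l.+1; rewrite /= (h k l.+2); last by lia.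
    rewrite mulr0 addr0 => /(_ _)/eqP; rewrite mulf_eq0 (negbTE c0) /= => /(_ _)/eqP.
    by apply; lia.
  have ltl : (lo < l)%N.
    by rewrite ltn_neqAle ll andbT; apply: contraNneq u0_lo => ->; rewrite ul.
  apply: (IH l.-1 r) => //; try lia.
  move=> k i hi'; have [->|il] := eqVneq i l; first exact: ul.
  by apply: h; lia.
- have ur k : u k r = 0.
    have := inner k r.-1; rewrite (h k r.-1.-1); last by lia.
    rewrite mulr0 add0r prednK; last by lia.
    move=> /(_ _)/eqP; rewrite mulf_eq0 (negbTE c0) /= => /(_ _)/eqP.
    by apply; lia.
  have ltr : (r < hi)%N.
    by rewrite ltn_neqAle rh andbT; apply: contraNneq u0_hi => <-; rewrite ur.
  apply: (IH l r.+1) => //; try lia.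
  move=> k i hi'; have [->|il] := eqVneq i r; first exact: ur.
  by apply: h; lia.
Qed.

Hypothesis u0_mid : forall i, (lo < i < hi)%N -> u 0 i = 0.

(* The block (p, r) would be driven only by p and r, whose sign s is opposite to
   its own: by induction on the order all its derivatives vanish, then so do
   those of a neighbour, contradicting [run_not_null]. *)
Lemma run_block s p r : s * s = 1 -> (lo <= p)%N -> (p.+1 < r)%N -> (r <= hi)%N ->
  lex_nonneg (fun k => s * u k p) -> lex_nonneg (fun k => s * u k r) ->
  ~ (forall i, (p < i < r)%N -> lex_nonneg (fun k => - (s * u k i))).
Proof.
move=> ss lp pr rh hp hr hmid.
have s0 : s != 0 by apply: contra_eq_neq ss => ->; rewrite mul0r eq_sym oner_neq0.
pose w k i := s * u k i.
(* [fl] and [fr] are the inflows into the block from [p] and from [r]; each enters at one end index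
   only. *)
pose fl i k := (if i == p.+1 then alpha i else 0) * w k p.
pose fr i k := (if i == r.-1 then beta i else 0) * w k r.
have fl_nn i : lex_nonneg (fl i).
  by apply: lex_nonnegZ => //; case: ifP.
have fr_nn i : lex_nonneg (fr i).
  by apply: lex_nonnegZ => //; case: ifP.
have wS k i : (p < i < r)%N -> (forall i, (p < i < r)%N -> w k i = 0) ->
    w k.+1 i = fl i k + fr i k.
  move=> hi' z; rewrite /w uS; last by lia.
  have -> : s * (d i * u k i + alpha i * u k i.-1 + beta i * u k i.+1) =
    d i * w k i + alpha i * w k i.-1 + beta i * w k i.+1 by rewrite /w; ring.
  rewrite z // mulr0 add0r /fl /fr; congr (_ + _).
    case: eqVneq => [->//|ip]; rewrite z ?mulr0 ?mul0r //; lia.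
  case: eqVneq => [->|ip]; first by rewrite prednK //; lia.
  by rewrite z ?mulr0 ?mul0r //; lia.
have w0 k : forall i, (p < i < r)%N -> w k i = 0.
  elim/ltn_ind: k => [[_ i hi'|k IH i hi']].
    by rewrite /w u0_mid ?mulr0 //; lia.
  have wSk := wS k i hi' (IH k (ltnSn k)).
  have ge0 : 0 <= w k.+1 i.
    rewrite wSk; apply: (lex_nonnegD (fl_nn i) (fr_nn i)) => m mk.
    by rewrite -wS ?IH // => j hj; rewrite IH //; lia.
  have le0 : 0 <= - w k.+1 i.
    by apply: (hmid i hi') => m mk; rewrite -/(w m i) IH ?oppr0.
  by apply/eqP; rewrite eq_le ge0 -oppr_ge0 le0.
(* The inflows sum to zero and are lexicographically nonnegative, so each vanishes separately, even
   when the block has a single index. *)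
have f0 i k : (p < i < r)%N -> fl i k = 0 /\ fr i k = 0.
  move=> hi'; apply: (lex_nonneg_add0 (k := k.+1) (fl_nn i) (fr_nn i)) => //.
  by move=> m _; rewrite -wS ?w0 // => j /w0.
have u0 k i : w k i = 0 -> u k i = 0.
  by move/eqP; rewrite mulf_eq0 (negbTE s0) => /eqP.
case: (irr lp pr rh) => c0.
- have up k : u k p = 0.
    have [|+ _] := f0 p.+1 k; first by lia.
    by rewrite /fl eqxx => /eqP; rewrite mulf_eq0 (negbTE c0) /= => /eqP/u0.
  have ltp : (lo < p)%N.
    by rewrite ltn_neqAle lp andbT; apply: contraNneq u0_lo => ->; rewrite up.
  apply: (@run_not_null p.-1 r) => //; try lia.
  move=> k i hi'; have [->|il] := eqVneq i p; first exact: up.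
  by apply/u0/w0; lia.
- have ur k : u k r = 0.
    have [|_ +] := f0 r.-1 k; first by lia.
    by rewrite /fr eqxx => /eqP; rewrite mulf_eq0 (negbTE c0) /= => /eqP/u0.
  have ltr : (r < hi)%N.
    by rewrite ltn_neqAle rh andbT; apply: contraNneq u0_hi => <-; rewrite ur.
  apply: (@run_not_null p r.+1) => //; try lia.
  move=> k i hi'; have [->|il] := eqVneq i r; first exact: ur.
  by apply/u0/w0; lia.
Qed.

(** Two consecutive changes would enclose a block of sign opposite to both its neighbours, which
    [run_block] excludes. *)
Lemma run_changes_le1 (e : nat -> bool) :
  (forall i, (lo <= i <= hi)%N -> lex_nonneg (fun k => (-1) ^+ e i * u k i)) ->
  (changes e lo hi <= 1)%N.
Proof.
move=> he; apply: changes_le1 => p q lp pq qh ep eq.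
have [/existsP[i /andP[/andP[pi iq] ei]]|] :=
    boolP [exists i : 'I_q.+1, (p < i <= q)%N && (e i != e p.+1)].
  by exists i; rewrite ?pi.
rewrite negb_exists => /forallP hc; exfalso.
have eb i : (p < i)%N -> (i <= q)%N -> e i = ~~ e p.
  move=> pi iq; have := hc (inord i); rewrite inordK ?ltnS // pi iq /= negbK.
  by move=> /eqP->; move: ep; case: (e p); case: (e p.+1).
have eq1 : e q.+1 = e p.
  by move: eq; rewrite eb //; case: (e p); case: (e q.+1).
have := @run_block ((-1) ^+ e p) p q.+1; apply => //.
- by rewrite -signr_addb addbb.
- by apply: he; lia.
- by rewrite -eq1; apply: he; lia.
- move=> i /andP[pi iq] k hk.
  have := he i _ k; rewrite eb // signrN mulNr; apply; first by lia.
  by move=> m /hk; rewrite mulNr.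
Qed.
End Run.

(** * The ring unrolled to a line *)

(** Multiplication by the alternating sign turns every change into a non-change and conversely. *)
Lemma changes_odd_twist (e : nat -> bool) a b : (a <= b)%N ->
  (changes (fun k => odd k (+) e k) a b + changes e a b = b - a)%N.
Proof.
move=> ab; rewrite /changes -big_split /= -[RHS]muln1 -sum_nat_const_nat.
apply: eq_bigr => k _; by case: (odd k); case: (e k); case: (e k.+1).
Qed.

Definition cyclic_changes (n : nat) (e : nat -> bool) : nat :=
  changes (fun k => e (k %% n)%N) 0 n.

(** Moving the window by one step trades the edge at [a] for the edge at [a + n], which is the same
    edge of the ring. *)
Lemma cyclic_changes_shift n (e : nat -> bool) a :
  changes (fun k => e (k %% n)%N) a (a + n) = cyclic_changes n e.
Proof.
elim: a => [|a <-]; first by rewrite add0n.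
rewrite addSn; case: n => [|n]; first by rewrite !addn0 /changes !big_geq.
rewrite /changes !addnS [RHS]big_nat_recl ?leq_addr // big_nat_recr /=; last by lia.
rewrite [RHS]addnC; congr addn; first by rewrite big_add1.
have e1 : ((a + n).+1 = a + n.+1)%N by rewrite addnS.
have e2 : ((a + n).+2 = a.+1 + n.+1)%N by rewrite addnS.
by rewrite e2 e1 !modnDr.
Qed.

Lemma cV_neq0 (R : nmodType) (n : nat) (y : 'cV[R]_n) :
  y != 0 -> exists i, y i 0 != 0.
Proof.
move=> y0; apply/existsP; apply: contraR y0 => /existsPn h.
apply/eqP/matrixP => i j; rewrite ord1 mxE; apply/eqP.
by rewrite -[_ == _]negbK.
Qed.

(** The weak inequality leaves [e] free wherever [y] vanishes. *)
Definition sign_compat (R : realFieldType) (n : nat) (e : nat -> bool)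
    (y : 'cV[R]_n) : Prop :=
  forall i : 'I_n, 0 <= (-1) ^+ e i * y i 0.

Lemma sign_compat_uniq (R : realFieldType) (b c : bool) (r : R) :
  r != 0 -> 0 <= (-1) ^+ b * r -> 0 <= (-1) ^+ c * r -> b = c.
Proof. by case: b; case: c => //; rewrite !(expr0, expr1) => /eqP; lra. Qed.

Lemma modnD_pred r n : (r < n)%N ->
  ((r + n.-1) %% n = if r == 0 then n.-1 else r.-1)%N.
Proof.
case: n => // n; case: r => [|r] rn /=; first by rewrite modn_small.
by rewrite addSnnS modnDr modn_small // ltnW.
Qed.

Lemma modnS_cyc r n : (r < n)%N -> (r.+1 %% n = if r.+1 == n then 0 else r.+1)%N.
Proof.
move=> rn; case: eqP => [->|r0]; first by rewrite modnn.
by rewrite modn_small // ltn_neqAle rn andbT; apply/eqP.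
Qed.

Lemma cyclic_adjacent_mod n r j : (r < n)%N -> (j < n)%N ->
  j != r -> j != ((r + n.-1) %% n)%N -> j != (r.+1 %% n)%N ->
  ~ [\/ r = j, j = r.+1 \/ r = j.+1, r = 0%N /\ j = n.-1 | r = n.-1 /\ j = 0%N].
Proof.
move=> rn jn; rewrite modnD_pred // modnS_cyc //.
case: (eqVneq r 0%N); case: (eqVneq r.+1 n); move=> a b /eqP c /eqP d /eqP e;
  case=> [|[]|[]|[]]; lia.
Qed.

(** * Cyclic tridiagonal matrices as three-term recurrences on the unrolled ring *)

Section CyclicIndex.
Variables (R : realType) (n : nat) (A : 'M[R]_n).
Hypothesis n_gt1 : (1 < n)%N.

Definition cyc (k : nat) : 'I_n := Ordinal (ltn_pmod k (ltnW n_gt1)).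

(** The left neighbour is reached by adding [n.-1], since subtraction of naturals would truncate at
    0. *)
Let left_coef i := A (cyc i) (cyc (i + n.-1)).
(* For n = 2 the two neighbours coincide and must be counted once. *)
Let right_coef i := if n == 2 then 0 else A (cyc i) (cyc i.+1).

Lemma cycD k : cyc (k + n) = cyc k.
Proof. by apply: val_inj; rewrite /= modnDr. Qed.

Lemma cyc_val (i : 'I_n) : cyc i = i.
Proof. by apply: val_inj; rewrite /= modn_small. Qed.

Lemma cyc_eq i j : (i < j)%N -> (j < i + n)%N -> cyc i != cyc j.
Proof.
move=> ij jn; apply/negP => /eqP /(congr1 val) /= h.
have : (n %| j - i)%N by rewrite -eqn_mod_dvd 1?ltnW // h.
by move/dvdn_leq; lia.
Qed.

Lemma cyc_pred i : (0 < i)%N -> cyc (i + n.-1) = cyc i.-1.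
Proof. by move=> i0; rewrite -[RHS]cycD; congr cyc; lia. Qed.

Hypothesis tri : cyclic_tridiagonal A.

Lemma cyclic_tridiagonal0 i j :
  j != cyc i -> j != cyc (i + n.-1) -> j != cyc i.+1 -> A (cyc i) j = 0.
Proof.
move=> h1 h2 h3; apply/eqP; apply: contraT => /tri h; rewrite -!val_eqE /= in h1 h2 h3.
have ri := ltn_pmod i (ltnW n_gt1).
exfalso; apply: (cyclic_adjacent_mod ri (ltn_ord j) h1).
- by rewrite modnDml.
- by rewrite -addn1 modnDml addn1.
- by case: h => [<-|h|h|h]; [constructor 1|constructor 2|constructor 3|constructor 4].
Qed.

Lemma mulmx_cyc (x : 'cV[R]_n) i :
  (A *m x) (cyc i) 0 = A (cyc i) (cyc i) * x (cyc i) 0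
    + left_coef i * x (cyc (i + n.-1)) 0 + right_coef i * x (cyc i.+1) 0.
Proof.
rewrite mxE (bigD1 (cyc i)) //= (bigD1 (cyc (i + n.-1))) /=; last first.
  by rewrite eq_sym cyc_eq //; lia.
rewrite -addrA; congr (_ + _); congr (_ + _).
rewrite /right_coef; case: eqP => [n2|n2].
  rewrite mul0r big1 // => j /andP[j1 j2]; rewrite cyclic_tridiagonal0 ?mul0r //.
  by rewrite (_ : i.+1 = i + n.-1)%N // n2 addn1.
rewrite (bigD1 (cyc i.+1)) /=; last first.
  have -> : cyc i.+1 != cyc i by rewrite eq_sym cyc_eq //; lia.
  by apply: cyc_eq; lia.
by rewrite big1 ?addr0 // => j /andP[/andP[j1 j2] j3]; rewrite cyclic_tridiagonal0 ?mul0r.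
Qed.

Hypothesis irrA : irreducible_mx A.

(** The arc strictly between [l] and [r] misses [l], so strong connectivity yields an edge leaving
    it; by tridiagonality such an edge can start only at one of the two ends of the arc. *)
Lemma arc_exit l r : (l.+1 < r)%N -> (r <= l + n)%N ->
  left_coef l.+1 != 0 \/ right_coef r.-1 != 0.
Proof.
move=> lr rl; pose S := [pred j | [exists i : 'I_r, (l < i)%N && (cyc i == j)]].
have Sl1 : S (cyc l.+1) by apply/existsP; exists (Ordinal lr); rewrite /= leqnn eqxx.
have Sl : ~~ S (cyc l).
  rewrite negb_exists; apply/forallP => i; rewrite negb_and -implybE; apply/implyP => li.
  by rewrite eq_sym cyc_eq //; have := ltn_ord i; lia.
have [k [m [Sk Sm Akm]]] : exists k m, [/\ S k, ~~ S m & A k m != 0].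
  case/connectP: (irrA (cyc l.+1) (cyc l)) => p.
  elim: p (cyc l.+1) Sl1 => [|z p IH] x Sx /=; first by move=> _ e; rewrite e Sx in Sl.
  case/andP => Axz hp hl; have [Sz|Sz] := boolP (S z); first exact: (IH z).
  by exists x, z.
case/existsP: Sk => [[i ir] /= /andP[li /eqP ik]].
have [/eqP mr|mr] := boolP (m == cyc (i + n.-1)).
  left; rewrite cyc_pred ?(leq_trans _ li)// in mr.
  have [e|il] := eqVneq i l.+1; first by rewrite /left_coef cyc_pred // -e ik -mr.
  have ir' : (i.-1 < r)%N by lia.
  move: Sm; rewrite mr => /existsPn /(_ (Ordinal ir')).
  by rewrite /= eqxx andbT; lia.
have [/eqP mi|mi] := boolP (m == cyc i.+1); last first.
  move: Akm; rewrite -ik cyclic_tridiagonal0 ?eqxx //.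
  by apply: contraNneq Sm => ->; apply/existsP; exists (Ordinal ir); rewrite /= li eqxx.
right; have [e|il] := eqVneq i r.-1.
  (* For [n = 2] both neighbours coincide, and [m] would have been caught as the left one. *)
  rewrite /right_coef -e ik -mi; case: (n =P 2%N) => // n2.
  by move: mr; rewrite mi -[i.+1]addn1 (_ : n.-1 = 1)%N ?eqxx // n2.
move: Sm; rewrite mi => /existsPn.
have ir' : (i.+1 < r)%N by lia.
by move=> /(_ (Ordinal ir')); rewrite /= eqxx andbT; lia.
Qed.

Hypothesis metzA : metzler A.

(** The iterates are the derivatives at the initial time of the solution starting at [y], for [A]
    or, when [b] holds, for [-A]. In the latter case the twist complements the counts, which
    reverses the inequality. *)
Lemma cyclic_changes_iter (b : bool) (y : 'cV[R]_n) (e e' : nat -> bool) :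
  y != 0 -> sign_compat e y ->
  (forall i : 'I_n, lex_nonneg
     (fun k => (-1) ^+ e' i * iter k (mulmx ((-1) ^+ b *: A)) y i 0)) ->
  if b then (cyclic_changes n e <= cyclic_changes n e')%N
  else (cyclic_changes n e' <= cyclic_changes n e)%N.
Proof.
move=> y0 ey e'y.
have [i0 yi0] := cV_neq0 y0.
(* For A replaced by -A, the pattern twisted by (-1)^k on the unrolled ring obeys
   the recurrence of A itself. *)
pose tw (f : nat -> bool) k := (b && odd k) (+) f (k %% n)%N.
have twE f a : (if b then changes (tw f) a (a + n) + cyclic_changes n f = n
    else changes (tw f) a (a + n) = cyclic_changes n f)%N.
  rewrite /tw; case: (b) => /=; last exact: cyclic_changes_shift.
  by rewrite -(cyclic_changes_shift n f a) changes_odd_twist ?leq_addr // addKn.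
(* The window starts and ends at lifts of [i0], where [y] is nonzero, so every run of zeros in it
   has nonzero ends. *)
suff H : (changes (tw e') (i0 + n) (i0 + n + n) <= changes (tw e) (i0 + n) (i0 + n + n))%N.
  by have := twE e (i0 + n)%N; have := twE e' (i0 + n)%N; move: H; case: (b); lia.
have Z0 : ~~ (y (cyc (i0 + n)) 0 == 0) by rewrite cycD cyc_val.
apply: (@changes_le_of_runs _ _ (fun k => y (cyc k) 0 == 0)) => //.
- exact: leq_addr.
- by rewrite cycD.
- move=> i _ yi; congr addb; apply: (sign_compat_uniq yi); first exact: (ey (cyc i)).
  by apply: (e'y (cyc i) 0%N).
move=> l r il lr ri yl yr yz.
pose u k i := (-1) ^+ (b && odd i) * iter k (mulmx ((-1) ^+ b *: A)) y (cyc i) 0.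
apply: (@run_changes_le1 R u (fun i => (-1) ^+ b * A (cyc i) (cyc i))
  left_coef right_coef).
- by move=> i; apply: metzA; apply: cyc_eq; lia.
- by move=> i; rewrite /right_coef; case: ifP => // n2; apply: metzA; apply: cyc_eq; lia.
- move=> k i /andP[li _].
  rewrite /u iterS -scalemxAl mxE mulmx_cyc cyc_pred ?(leq_trans _ li) //.
  case: i li => // i _ /=; case: (b) => /=; last by rewrite !expr0; ring.
  by rewrite negbK; case: (odd i) => /=; rewrite ?expr0 ?expr1; ring.
- move=> l' r' ll lr' rr; apply: arc_exit => //; lia.
- by rewrite /u mulf_neq0 // signr_eq0.
- by rewrite /u mulf_neq0 // signr_eq0.
- by move=> i hi; rewrite /u (eqP (yz i hi)) mulr0.
- move=> i _; rewrite /tw /u.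
  suff -> : (fun k => (-1) ^+ ((b && odd i) (+) e' (i %% n)%N) *
     ((-1) ^+ (b && odd i) * iter k (mulmx ((-1) ^+ b *: A)) y (cyc i) 0)) =
     (fun k => (-1) ^+ e' (cyc i) * iter k (mulmx ((-1) ^+ b *: A)) y (cyc i) 0).
    exact: e'y.
  by apply/funext => k; rewrite mulrA -signr_addb addbAC addbb addFb.
Qed.
End CyclicIndex.

(** * Cyclic sign variations as extrema over sign patterns *)

Section Sequences.
Variable R : realType.
Implicit Types (y z : seq R).

Fixpoint switches (b : bool) (s : seq bool) : nat :=
  if s is c :: s' then ((b (+) c) + switches c s')%N else 0%N.

Lemma switches_head b c s : (switches b s <= (b (+) c) + switches c s)%N.
Proof. by case: s => [|a s] //=; case: a; case: b; case: c => //=; lia. Qed.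

Lemma switches_nth b s :
  switches b s = (\sum_(k < size s) (nth false (b :: s) k (+) nth false (b :: s) k.+1))%N.
Proof.
elim: s b => [|c s IH] b; first by rewrite big_ord0.
by rewrite [RHS]big_ord_recl /= IH.
Qed.

Definition neg (r : R) : bool := r < 0.

Lemma mulr_lt0_neg (r s : R) : r != 0 -> s != 0 -> (r * s < 0) = neg r (+) neg s.
Proof.
rewrite /neg => r0 s0; case: (ltgtP r 0) r0 => // hr _; case: (ltgtP s 0) s0 => // hs _ /=.
- by apply/negbTE; rewrite -leNgt; nra.
- by nra.
- by nra.
- by apply/negbTE; rewrite -leNgt; nra.
Qed.

Lemma sign_changes_switches r y : all (fun x => x != 0) (r :: y) ->
  sign_changes (r :: y) = switches (neg r) [seq neg r | r <- y].
Proof.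
move=> /allP nz; rewrite switches_nth /sign_changes /= size_map.
apply: eq_bigr => -[k hk] _ /=; 
have n1 : (r :: y)`_k != 0 by apply/nz/mem_nth; rewrite ltnS ltnW.
have n2 : y`_k != 0 by apply: (nz (r :: y)`_k.+1); apply: mem_nth.
rewrite mulr_lt0_neg //.
rewrite -[neg r :: _]/([seq neg x | x <- r :: y]) !(nth_map 0) //=.
by rewrite ltnS ltnW.
Qed.

Definition seq_compat (e : seq bool) y : bool :=
  all2 (fun (b : bool) r => 0 <= (-1) ^+ b * r) e y.

Lemma neg_compat (b : bool) (r : R) : r != 0 -> 0 <= (-1) ^+ b * r -> neg r = b.
Proof. by rewrite /neg; case: b; case: ltgtP => // h _; rewrite ?expr0 ?expr1; nra. Qed.

Lemma compat_neg (r : R) : 0 <= (-1) ^+ neg r * r.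
Proof. by rewrite /neg; case: ltP => h; rewrite ?expr0 ?expr1; nra. Qed.

Definition nz_signs y : seq bool := [seq neg r | r <- [seq x <- y | x != 0]].

(** Nonzero entries determine their signs in [e], and deleting the other entries cannot create a
    change. *)
Lemma switches_filter_le b e y : seq_compat e y ->
  (switches b (nz_signs y) <= switches b e)%N.
Proof.
elim: y b e => [|r y IH] b [|c e] //= /andP[h he]; rewrite /nz_signs /=.
have [->|r0] /= := eqVneq r 0.
  by apply: leq_trans (switches_head b c _) _; rewrite leq_add2l IH.
by rewrite (neg_compat r0 h) leq_add2l IH.
Qed.

Lemma s_minus_le c e y : seq_compat (c :: e) y -> (s_minus y <= switches c e)%N.
Proof.
elim: y c e => [|r y IH] c [|d e] //= /andP[h he].
- by case: y he IH => //= he _; rewrite /s_minus /=; case: eqVneq => _; rewrite /sign_changes /= ?big_ord0.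
- have [r0|r0] := eqVneq r 0.
    by rewrite /s_minus /= r0 eqxx /= (leq_trans (IH d e he)) // leq_addl.
  rewrite /s_minus /= r0 sign_changes_switches /=; last first.
    by rewrite r0; apply/allP => x; rewrite mem_filter => /andP[].
  by rewrite (neg_compat r0 h); exact: (@switches_filter_le c (d :: e)).
Qed.

(** Each zero repeats the last sign before it, initially [b], and so adds no change. *)
Lemma switches_filter_ex b y : exists2 e, seq_compat e y &
  switches b e = switches b (nz_signs y).
Proof.
elim: y b => [|r y IH] b; first by exists [::].
have [->|r0] := eqVneq r 0.
  have [e he ee] := IH b; exists (b :: e); first by rewrite /= mulr0 lexx.
  by rewrite /nz_signs /= eqxx /= addbb ee.
have [e he ee] := IH (neg r); exists (neg r :: e); first by rewrite /= compat_neg.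
by rewrite /nz_signs /= r0 /= ee.
Qed.

End Sequences.

(** * Patterns on the ring and the two cyclic sign variations *)

Section Vectors.
Variables (R : realType) (n : nat).
Hypothesis n_gt0 : (0 < n)%N.
Implicit Types (y : 'cV[R]_n) (e : nat -> bool).

Lemma size_cv_seq y : size (cv_seq y) = n.
Proof. by rewrite size_map size_enum_ord. Qed.

Lemma nth_cv_seq y (i : 'I_n) : (cv_seq y)`_i = y i 0.
Proof. by rewrite (nth_map i) ?size_enum_ord // nth_ord_enum. Qed.

Lemma size_ring_from y i : (i < n)%N -> size (ring_from (cv_seq y) i) = n.+1.
Proof.
move=> hi; rewrite size_cat size_drop size_takel size_cv_seq //.
by rewrite addnS subnK // ltnW.
Qed.

Lemma nth_ring_from y i k : (i < n)%N -> (k <= n)%N ->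
  (ring_from (cv_seq y) i)`_k = (cv_seq y)`_((i + k) %% n).
Proof.
move=> hi hk; rewrite nth_cat size_drop size_cv_seq.
case: ltnP => h; first by rewrite nth_drop modn_small //; lia.
rewrite nth_take; last by lia.
congr nth; rewrite (_ : i + k = k - (n - i) + n)%N ?modnDr ?modn_small //; lia.
Qed.

Lemma sign_compat_mod y e k : sign_compat e y ->
  0 <= (-1) ^+ e (k %% n)%N * (cv_seq y)`_(k %% n).
Proof. by move=> he; rewrite -[(k %% n)%N]/(val (Ordinal (ltn_pmod k n_gt0))) nth_cv_seq; apply: he. Qed.

(** The two ends of an admissible filling are equal, so its signs descend to a pattern on the
    ring. *)
Lemma sc_plus_le y m :
  (forall e, sign_compat e y -> (cyclic_changes n e <= m)%N) ->
  (sc_plus (cv_seq y) <= m)%N.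
Proof.
move=> H; apply/bigmax_leqP => -[i] /=; rewrite size_cv_seq => hi _.
apply/bigmax_leqP_seq => z /mapP[eps _ zE] /eqP hl.
have sz : size z = n.+1.
  by rewrite zE /fill_zeros size_map size_zip size_tuple size_ring_from // minnn.
have zk k : (k <= n)%N -> z`_k != 0 /\ 0 <= (-1) ^+ neg z`_k * (cv_seq y)`_((i + k) %% n).
  move=> hk; rewrite -nth_ring_from // zE /fill_zeros.
  have hs : (k < size (zip (ring_from (cv_seq y) i) eps))%N.
    by rewrite size_zip size_tuple size_ring_from // minnn.
  rewrite (nth_map (0, false)) // nth_zip ?size_tuple //=.
  case: ifPn => [/eqP -> |h]; first by rewrite signr_eq0 mulr0.
  by rewrite h compat_neg.
(* Ring index [j] is read at position [j - i] modulo [n]; adding [n - i] avoids truncated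
   subtraction. *)
pose e j := neg z`_((j + (n - i)) %% n).
have hz0 : z`_n = z`_0.
  by move: hl; rewrite -nth0 -nth_last sz /= => ->.
have ee k : (k <= n)%N -> e ((i + k) %% n)%N = neg z`_k.
  move=> hk; rewrite /e modnDml (_ : i + k + (n - i) = k + n)%N; last by lia.
  rewrite modnDr; move: hk; rewrite leq_eqVlt => /orP[/eqP->|hk]; last by rewrite modn_small.
  by rewrite modnn hz0.
apply: (leq_trans _ (H e _)).
  rewrite -(cyclic_changes_shift n e i) /sign_changes sz /= /changes (big_addn 0 _ i) addKn big_mkord leq_eqVlt.
  apply/orP/or_introl/eqP/eq_bigr => -[k hk] _ /=.
  have [z0 _] := zk k (ltnW hk); have [z1 _] := zk k.+1 hk.
  by rewrite mulr_lt0_neg // addnC -addnS ee ?ee // ltnW.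
move=> j; rewrite -nth_cv_seq.
have [|_] := zk ((j + (n - i)) %% n)%N; first by rewrite ltnW // ltn_pmod.
rewrite modnDmr (_ : i + (j + (n - i)) = j + n)%N; last by lia.
by rewrite modnDr (modn_small (ltn_ord j)).
Qed.

(** Read the ring from index 0 and fill each zero with the sign that [e] prescribes; both ends then
    get the sign [e 0]. *)
Lemma sc_plus_ge y e : sign_compat e y ->
  (cyclic_changes n e <= sc_plus (cv_seq y))%N.
Proof.
move=> he; have h0 : (0 < size (cv_seq y))%N by rewrite size_cv_seq.
apply: leq_trans (leq_bigmax (Ordinal h0)) => /=.
set ys := ring_from _ _; have szy : size ys = n.+1 by apply: size_ring_from.
have [eps epsk] : exists eps : n.+1.-tuple bool,
    forall k, (k <= n)%N -> nth false eps k = e (k %% n)%N.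
  by exists [tuple of mkseq (fun k => e (k %% n)%N) n.+1] => k hk; rewrite nth_mkseq.
pose z := fill_zeros ys eps.
have sz : size z = n.+1 by rewrite size_map size_zip size_tuple szy minnn.
have zE k : (k <= n)%N -> z`_k = if ys`_k == 0 then (-1) ^+ nth false eps k else ys`_k.
  move=> hk; have se : size ys = size eps by rewrite szy size_tuple.
  have hs : (k < size (zip ys eps))%N by rewrite size_zip -se minnn szy.
  by rewrite /z /fill_zeros (nth_map (0, false)) // nth_zip.
have zk k : (k <= n)%N -> z`_k != 0 /\ neg z`_k = e (k %% n)%N.
  move=> hk; rewrite zE // epsk //.
  case: ifPn => [_ |h]; first by rewrite signr_eq0 /neg signr_lt0.
  split => //; apply: neg_compat => //; rewrite nth_ring_from // add0n; exact: sign_compat_mod.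
suff: (cyclic_changes n e <= sign_changes z)%N.
  move/leq_trans; apply.
  apply: (@leq_bigmax_seq _ _ _ (fun z => sign_changes z)).
    apply/mapP; rewrite -/ys; move: eps epsk @z sz zE zk; rewrite -szy => eps _ z _ _ _.
    by exists eps; rewrite ?mem_enum.
  have hn0 : z`_n = z`_0.
    rewrite !zE // !epsk // modnn mod0n.
    by rewrite !nth_ring_from // add0n addn0 modnn mod0n.
  by rewrite -nth0 -nth_last sz /= hn0.
rewrite /cyclic_changes /changes big_mkord /sign_changes sz /=.
rewrite leq_eqVlt; apply/orP/or_introl/eqP/eq_bigr => -[k hk] _ /=.
have [z0 e0] := zk k (ltnW hk); have [z1 e1] := zk k.+1 hk.
by rewrite mulr_lt0_neg // e0 e1.
Qed.

Lemma sc_minus_le y e : sign_compat e y ->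
  (sc_minus (cv_seq y) <= cyclic_changes n e)%N.
Proof.
move=> he; apply/bigmax_leqP => -[i] /=; rewrite size_cv_seq => hi _.
rewrite -(cyclic_changes_shift n e i).
pose es := mkseq (fun k => e ((i + k) %% n)%N) n.+1.
have ec : seq_compat es (ring_from (cv_seq y) i).
  rewrite /seq_compat all2E size_mkseq size_ring_from // eqxx /=.
  apply/(all_nthP (false, 0)) => k; rewrite size_zip size_mkseq size_ring_from // minnn ltnS => hk.
  rewrite nth_zip ?size_mkseq ?size_ring_from //= nth_mkseq // nth_ring_from //.
  exact: sign_compat_mod.
have esk k : (k <= n)%N -> nth false es k = e ((i + k) %% n)%N by move=> hk; rewrite nth_mkseq.
have ses : size es = n.+1 by rewrite size_mkseq.
case: es ec esk ses => [//|c es] ec esk [ses].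
apply: leq_trans (s_minus_le ec) _; rewrite switches_nth ses.
rewrite /changes (big_addn 0 _ i) addKn big_mkord leq_eqVlt.
apply/orP/or_introl/eqP/eq_bigr => -[k hk] _.
by rewrite !esk ?(ltnW hk) // addnS addnC.
Qed.

(** Start at a nonzero entry and let every zero repeat the sign before it. The pattern closes up
    around the ring because the last entry is again that nonzero one. *)
Lemma sc_minus_attained y : exists2 e, sign_compat e y &
  (cyclic_changes n e <= sc_minus (cv_seq y))%N.
Proof.
have [/eqP y0|] := boolP (y == 0).
  exists (fun _ => false); first by move=> i; rewrite y0 mxE mulr0.
  by rewrite /cyclic_changes /changes big1.
move=> y0; have [i yi0] := cV_neq0 y0.
have hi : (i < size (cv_seq y))%N by rewrite size_cv_seq.
pose ys := ring_from (cv_seq y) i.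
have szy : size ys = n.+1 by apply: size_ring_from.
have ysk k : (k <= n)%N -> ys`_k = (cv_seq y)`_((i + k) %% n) by apply: nth_ring_from.
case E : ys szy => [//|r ys'] [sz'].
have rE : r = y i 0.
  by have := ysk 0%N isT; rewrite E addn0 modn_small // nth_cv_seq.
have [es ec es_sw] := switches_filter_ex (neg r) ys'.
have ses : size es = n by move: ec; rewrite /seq_compat all2E => /andP[/eqP->].
have r0 : r != 0 by rewrite rE.
have eck k : (k <= n)%N -> 0 <= (-1) ^+ nth false (neg r :: es) k * (cv_seq y)`_((i + k) %% n).
  move=> hk; rewrite -ysk // E; case: k hk => [|k] hk /=; first exact: compat_neg.
  move: ec; rewrite /seq_compat all2E => /andP[_ /(all_nthP (false, 0))/(_ k)].
  by rewrite size_zip ses sz' minnn => /(_ hk); rewrite nth_zip ?ses.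
pose e j := nth false (neg r :: es) ((j + (n - i)) %% n).
have e_last : nth false (neg r :: es) n = neg r.
  apply/esym/neg_compat => //; have := eck n (leqnn n).
  by rewrite modnDr modn_small // nth_cv_seq rE.
have ee k : (k <= n)%N -> e ((i + k) %% n)%N = nth false (neg r :: es) k.
  have := ltn_ord i => hi' hk; rewrite /e modnDml (_ : i + k + (n - i) = k + n)%N; last by lia.
  rewrite modnDr; move: hk; rewrite leq_eqVlt => /orP[/eqP->|hk]; last by rewrite modn_small.
  by rewrite modnn e_last.
exists e.
  move=> j; rewrite -nth_cv_seq; have := ltn_ord i => hi'.
  have := eck ((j + (n - i)) %% n)%N; rewrite -/(e j) modnDmr.
  rewrite (_ : i + (j + (n - i)) = j + n)%N; last by lia.
  by rewrite modnDr (modn_small (ltn_ord j)); apply; rewrite ltnW // ltn_pmod.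
apply: leq_trans (leq_bigmax (Ordinal hi)) => /=; rewrite -/ys E /s_minus /= r0.
rewrite sign_changes_switches /=; last first.
  by rewrite r0; apply/allP => x; rewrite mem_filter => /andP[].
rewrite -es_sw switches_nth ses -(cyclic_changes_shift n e i).
rewrite /changes (big_addn 0 _ i) addKn big_mkord leq_eqVlt.
apply/orP/or_introl/eqP/eq_bigr => -[k hk] _ /=.
by rewrite addnC -addnS !ee // (ltnW hk).
Qed.
End Vectors.

(** * Sign patterns along solutions *)

Section RealFunctions.
Local Open Scope classical_set_scope.
Variable R : realType.

Lemma is_derive_mull (a : R) (f : R -> R) (t df : R) :
  is_derive t (1 : R) f df -> is_derive t (1 : R) (fun s => a * f s) (a * df).
Proof. by move=> h; exact: (@is_deriveZ R R R f a t 1 df h). Qed.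

Lemma mean_value (f df : R -> R) (a b : R) : a < b ->
  (forall t, a <= t <= b -> is_derive t (1 : R) f (df t)) ->
  exists2 c, a < c < b & f b - f a = df c * (b - a).
Proof.
move=> ab fd.
have fd' x : x \in `]a, b[%R -> is_derive x (1 : R) f (df x).
  by rewrite in_itv /= => /andP[ax xb]; apply: fd; rewrite !ltW.
have fc : {within `[a, b], continuous f}.
  apply: derivable_within_continuous => x; rewrite in_itv /= => /fd h.
  exact: ex_derive.
by have [c] := MVT ab fd' fc; rewrite in_itv /= => h; exists c.
Qed.

Lemma near_right_ex (P : R -> Prop) (t : R) : (\forall s \near t^'+, P s) ->
  exists2 d, 0 < d & forall s, t < s < t + d -> P s.
Proof.
move=> [d /= d0 h]; exists d => // s /andP[ts sd]; apply: h => //=.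
by rewrite distrC gtr0_norm ?subr_gt0 // ltrBlDl.
Qed.

(** Induction on [k]: the derivative is positive just after [t0], and the mean value theorem passes
    this on to the function. *)
Lemma iterated_derivative_pos (f : nat -> R -> R) (t0 : R) k :
  (forall m t, is_derive t (1 : R) (f m) (f m.+1 t)) ->
  (forall m, (m < k)%N -> f m t0 = 0) -> 0 < f k t0 ->
  \forall t \near t0^'+, 0 < f 0%N t.
Proof.
move=> fd; elim: k f fd => [|k IH] f fd f0 fk.
  have fc : {for t0, continuous (f 0%N)}.
    apply: differentiable_continuous; apply/derivable1_diffP.
    by have := fd 0%N t0 => h; apply: ex_derive.
  exact: (cvgr_gt (f 0%N t0) (cvg_at_right_filter fc)).
have /near_right_ex[d d0 hd] : \forall t \near t0^'+, 0 < f 1%N t.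
  by apply: (IH (fun m => f m.+1)) => // m mk; apply: f0.
near=> t.
have t0t : t0 < t by near: t; exact: nbhs_right_gt.
have td : t < t0 + d by near: t; apply: nbhs_right_lt; rewrite ltrDl.
have [c /andP[c1 c2]] := mean_value t0t (fun s _ => fd 0%N s).
rewrite (f0 0%N) // subr0 => ->; rewrite mulr_gt0 ?subr_gt0 // hd // c1.
exact: lt_trans td.
Unshelve. all: by end_near. Qed.

(** If the first nonzero derivative contradicts the sign [b], so does the function itself just after
    [t0], strictly. If all derivatives vanish, both signs are allowed. *)
Lemma lex_nonneg_near_right (f : nat -> R -> R) (t0 : R) :
  (forall m t, is_derive t (1 : R) (f m) (f m.+1 t)) ->
  \forall t \near t0^'+, forall b : bool, 0 <= (-1) ^+ b * f 0%N t ->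
    lex_nonneg (fun k => (-1) ^+ b * f k t0).
Proof.
move=> fd; apply: filter_forall => b.
have [h|] := pselect (lex_nonneg (fun k => (-1) ^+ b * f k t0)).
  by near=> t.
move=> /existsNP[k /not_implyP[h0 /negP]]; rewrite -ltNge => hk.
pose g m t := (- (-1) ^+ b) * f m t.
have gd m t : is_derive t (1 : R) (g m) (g m.+1 t) by apply: is_derive_mull.
have g0 m : (m < k)%N -> g m t0 = 0 by move=> /h0; rewrite /g mulNr => ->; rewrite oppr0.
have gk : 0 < g k t0 by rewrite /g mulNr oppr_gt0.
have := iterated_derivative_pos gd g0 gk.
apply: filterS => t; rewrite /g mulNr oppr_gt0 => h /le_lt_trans /(_ h).
by rewrite ltxx.
Unshelve. all: by end_near. Qed.

(** Let [S] be the set of times up to which [P] holds. [P] holds at its supremum by closedness, and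
    then beyond it, a contradiction if [P] fails at some [T]. *)
Lemma real_induction (P : R -> Prop) (t0 : R) : P t0 ->
  (forall t, t0 <= t -> P t -> exists2 d, 0 < d & forall s, t < s < t + d -> P s) ->
  (forall t, t0 < t -> (forall s, t0 <= s < t -> P s) -> P t) ->
  forall t, t0 <= t -> P t.
Proof.
move=> P0 Pright Pclosed T t0T; apply: contrapT => PT.
pose S := [set t | t0 <= t /\ forall s, t0 <= s <= t -> P s].
have St0 : S t0 by split=> // s /andP[h1 h2]; rewrite (_ : s = t0) //; apply/le_anti/andP.
have ubT : ubound S T.
  move=> t [t0t h]; rewrite leNgt; apply/negP => Tt.
  by apply/PT/h; rewrite t0T ltW.
have hS : has_sup S by split; [exists t0|exists T].
have S0 : t0 <= sup S by apply: ub_le_sup => //; exists T.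
have below s : t0 <= s < sup S -> P s.
  move=> /andP[h1 h2].
  have e0 : 0 < sup S - s by rewrite subr_gt0.
  have [t [_ ht]] := sup_adherent e0 hS; rewrite subKr => st.
  by apply: ht; rewrite h1 ltW.
have PS : P (sup S).
  have [<-//|t0S] := eqVneq t0 (sup S).
  by apply: Pclosed => //; rewrite lt_neqAle t0S.
have [d d0 hd] := Pright _ S0 PS.
have d2 : 0 < d / 2 by rewrite divr_gt0.
have Sd : S (sup S + d / 2).
  split; first by rewrite ler_wpDr // ltW.
  move=> s /andP[h1 h2]; case: (ltgtP s (sup S)) => [h|h|->//].
    by apply: below; rewrite h1.
  by apply: hd; rewrite h (le_lt_trans h2) // ltrD2l; lra.
have ubS : has_ubound S by exists T.
by have := ub_le_sup ubS Sd; rewrite leNgt ltrDl d2.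
Qed.

End RealFunctions.

(** * Linear systems and the decay of cyclic changes *)

Section LinearSystems.
Local Open Scope classical_set_scope.
Variables (R : realType) (n : nat).
Implicit Types (A B : 'M[R]_n) (x : R -> 'cV[R]_n).

Definition solves A x (t : R) : Prop :=
  forall i, is_derive t (1 : R) (fun s => x s i 0) ((A *m x t) i 0).

Lemma is_derive_bigsum (F : 'I_n -> R -> R) (dF : 'I_n -> R) (t : R) :
  (forall i, is_derive t (1 : R) (F i) (dF i)) ->
  is_derive t (1 : R) (fun s => \sum_i F i s) (\sum_i dF i).
Proof.
move=> h; have := is_derive_sum h; congr is_derive.
by apply/funext => s; rewrite fct_sumE.
Qed.

Lemma solves_iter A x k t : (forall t, solves A x t) -> forall i,
  is_derive t (1 : R) (fun s => iter k (mulmx A) (x s) i 0)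
    (iter k.+1 (mulmx A) (x t) i 0).
Proof.
move=> h; elim: k t => [|k IH] t i; first exact: h.
have -> : (fun s => iter k.+1 (mulmx A) (x s) i 0) =
    (fun s => \sum_j A i j * iter k (mulmx A) (x s) j 0).
  by apply/funext => s; rewrite iterS mxE.
rewrite iterS mxE.
exact: (is_derive_bigsum (fun j => is_derive_mull (A i j) (IH t j))).
Qed.

Lemma solves_opp A x t : solves A x (- t) ->
  solves ((-1) *: A) (fun s => x (- s)) t.
Proof.
move=> h i; rewrite -scalemxAl mxE.
have hn : is_derive t (1 : R) -%R (-1) by exact: is_deriveNid.
have := @is_derive1_comp R (fun s => x s i 0) -%R t _ _ (h i) hn.
by rewrite mulrC.
Qed.

(** The squared norm [g] satisfies [|g'| <= K g], so [expR (- K * t) * g t] is nonincreasing and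
    [expR (K * t) * g t] nondecreasing; each gives one direction. *)
Lemma gronwall_zero A x (t0 t1 : R) : t0 < t1 ->
  (forall t, t0 <= t <= t1 -> solves A x t) -> x t0 = 0 <-> x t1 = 0.
Proof.
move=> t01 h; pose g t := \sum_i x t i 0 ^+ 2.
pose dg t := \sum_i (x t i 0 * (A *m x t) i 0) *+ 2.
(* The factor 2 comes from bounding [2 |x_i x_j|] by the sum of two squares, each at most [g]. *)
pose K := \sum_i \sum_j `|A i j| * 2.
have g0 t : 0 <= g t by apply: sumr_ge0 => i _; rewrite sqr_ge0.
have geq0 t : g t = 0 <-> x t = 0.
  split=> [|h0]; last by rewrite /g h0 big1 // => i _; rewrite mxE expr0n.
  move=> /eqP; rewrite psumr_eq0 => [/allP/= hi|i _]; last exact: sqr_ge0.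
  apply/matrixP => i j; rewrite ord1 mxE; apply/eqP.
  by rewrite -sqrf_eq0; apply: hi; rewrite mem_index_enum.
have gd t : t0 <= t <= t1 -> is_derive t (1 : R) g (dg t).
  move=> ht; apply: is_derive_bigsum => i; have hi := h t ht i.
  have := @is_deriveX R R (fun s => x s i 0) 2 t 1 _ hi.
  by congr is_derive; rewrite /= expr1 -mulr_natl /GRing.scale /=; ring.
have dgK t : `|dg t| <= K * g t.
  rewrite /dg /K; apply: le_trans (ler_norm_sum _ _ _) _; rewrite mulr_suml.
  apply: ler_sum => i _; rewrite normrMn normrM mxE.
  have xg j : x t j 0 ^+ 2 <= g t.
    by rewrite /g (bigD1 j) //= lerDl sumr_ge0 // => ? _; rewrite sqr_ge0.
  apply: le_trans (_ : (`|x t i 0| * \sum_j `|A i j * x t j 0|) *+ 2 <= _).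
    by rewrite lerMn2r ler_wpM2l // ler_norm_sum.
  rewrite mulr_sumr -sumrMnl mulr_suml; apply: ler_sum => j _.
  rewrite normrM mulrCA -mulrnAr -mulrA ler_wpM2l //.
  have := xg i; have := xg j; rewrite -(real_normK (num_real (x t i 0))).
  rewrite -(real_normK (num_real (x t j 0))) !expr2 => hj hi.
  have := sqr_ge0 (`|x t i 0| - `|x t j 0|); rewrite expr2; nra.
have Ed c (s : R) : is_derive s (1 : R) (fun t => expR (c * t)) (c * expR (c * s)).
  have hc : is_derive s (1 : R) (fun t => c * t) c.
    by have := is_derive_mull c (is_derive_id s (1 : R)); rewrite mulr1.
  have := @is_derive1_comp R expR (fun t => c * t) s _ _ (is_derive_expR _) hc.
  by rewrite mulrC.
have Egd c t : t0 <= t <= t1 ->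
    is_derive t (1 : R) (fun t => expR (c * t) * g t) (expR (c * t) * (c * g t + dg t)).
  move=> ht; have := is_deriveM (Ed c t) (gd t ht).
  by congr is_derive; rewrite /GRing.scale /=; ring.
split => /geq0 gz; apply/geq0/le_anti/andP; split => //.
- have [c /andP[c1 c2]] := mean_value t01 (Egd (- K)).
  rewrite gz mulr0 subr0 => e.
  have : expR (- K * t1) * g t1 <= 0.
    rewrite e mulr_le0_ge0 ?subr_ge0 ?(ltW t01) // mulr_ge0_le0 ?expR_ge0 //.
    by rewrite mulNr addrC subr_le0; apply: le_trans (dgK c); rewrite ler_norm.
  by rewrite pmulr_rle0 // expR_gt0.
- have [c /andP[c1 c2]] := mean_value t01 (Egd K).
  rewrite gz mulr0 sub0r => e.
  have : 0 <= - (expR (K * t0) * g t0).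
    rewrite e mulr_ge0 ?subr_ge0 ?(ltW t01) // mulr_ge0 ?expR_ge0 //.
    by rewrite -[dg c]opprK subr_ge0; apply: le_trans (dgK c); rewrite -normrN ler_norm.
  by rewrite oppr_ge0 pmulr_rle0 // expR_gt0.
Qed.

Hypothesis n_gt1 : (1 < n)%N.
Variable A : 'M[R]_n.
Hypothesis QA : Qplus A.

(** Only finitely many indices and signs are tested, so one neighbourhood serves all patterns at
    once. *)
Lemma near_right_changes (b : bool) x t0 :
  (forall t, solves ((-1) ^+ b *: A) x t) -> x t0 != 0 ->
  \forall t \near t0^'+, forall e e', sign_compat e (x t0) -> sign_compat e' (x t) ->
    if b then (cyclic_changes n e <= cyclic_changes n e')%N
    else (cyclic_changes n e' <= cyclic_changes n e)%N.
Proof.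
move=> xs x0; case: QA => metzA irrA triA.
have : \forall t \near t0^'+, forall (i : 'I_n) (c : bool),
    0 <= (-1) ^+ c * iter 0 (mulmx ((-1) ^+ b *: A)) (x t) i 0 ->
    lex_nonneg (fun k => (-1) ^+ c * iter k (mulmx ((-1) ^+ b *: A)) (x t0) i 0).
  apply: filter_forall => i.
  apply: (@lex_nonneg_near_right R
    (fun k t => iter k (mulmx ((-1) ^+ b *: A)) (x t) i 0)) => m t.
  exact: solves_iter.
apply: filterS => t ht e e' he he'.
apply: (cyclic_changes_iter n_gt1 triA irrA metzA x0 he) => i.
exact/ht/he'.
Qed.

Lemma cyclic_changes_decay x t0 t1 : (forall t, solves A x t) -> t0 < t1 ->
  x t0 != 0 -> (sc_plus (cv_seq (x t1)) <= sc_minus (cv_seq (x t0)))%N.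
Proof.
move=> xs t01 x0; have n_gt0 := ltnW n_gt1; set m := sc_minus _.
have xN0 t : t0 <= t -> x t != 0.
  rewrite le_eqVlt => /orP[/eqP<-//|tt]; apply: contraNneq x0 => xt.
  by apply/eqP/(gronwall_zero tt _).2 => // s _; apply: xs.
(* The induction runs on [P], since at [t0] only one good pattern is provided. From [P] at [t], the
   forward estimate gives [Q] just after [t]; from [P] before [t], the time-reversed one gives [Q]
   at [t]. *)
pose P t := exists2 e, sign_compat e (x t) & (cyclic_changes n e <= m)%N.
pose Q t := forall e, sign_compat e (x t) -> (cyclic_changes n e <= m)%N.
have QP t : Q t -> P t.
  by move=> q; have [e he _] := sc_minus_attained n_gt0 (x t); exists e; last exact: q.
have fwd t : t0 <= t -> P t -> exists2 d, 0 < d & forall s, t < s < t + d -> P s.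
  move=> tt [e he em].
  have xs' s : solves ((-1) ^+ false *: A) x s by rewrite scale1r.
  have [d d0 hd] := near_right_ex (near_right_changes xs' (xN0 t tt)).
  exists d => // s /hd h; apply: QP => e' he'.
  exact: leq_trans (h e e' he he') em.
have bwd t : t0 < t -> (forall s, t0 <= s < t -> P s) -> Q t.
  move=> tt hP e he.
  have xs' s : solves ((-1) ^+ true *: A) (fun s => x (- s)) s by apply: solves_opp.
  have xt : x (- - t) != 0 by rewrite opprK xN0 // ltW.
  have [d d0 hd] := near_right_ex (near_right_changes xs' xt).
  (* The first bound keeps [t - h] inside the neighbourhood of radius [d], the second keeps it at or
     after [t0]. *)
  pose h := Num.min (d / 2) (t - t0).
  have h0 : 0 < h by rewrite lt_min divr_gt0 //= subr_gt0.
  have hd2 : h <= d / 2 by rewrite ge_min lexx.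
  have ht : h <= t - t0 by rewrite ge_min lexx orbT.
  have [e' he' em] : P (t - h) by apply: hP; rewrite ltrBlDr ltrDl h0 andbT; lra.
  have hs : - t < - (t - h) < - t + d by apply/andP; split; lra.
  have := hd _ hs e e'; rewrite !opprK => /(_ he he') /leq_trans; exact.
have Pt t : t0 <= t -> P t.
  apply: real_induction => // [|s s0 hs]; last exact/QP/bwd.
  exact: sc_minus_attained.
by apply: (sc_plus_le n_gt0); apply: bwd => // s /andP[/Pt].
Qed.

End LinearSystems.

(** * The matrix exponential *)

Section MatrixExponential.
Local Open Scope classical_set_scope.
Variables (R : realType) (n : nat) (A : 'M[R]_n).

Let pow k : 'M[R]_n := iter k (mulmx A) 1%:M.
(** These are the power series coefficients of the [p]-th derivative of an entry of the
    exponential. *)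
Let coef p i j (k : nat) : R := pow (k + p) i j / k`!%:R.
Let N : R := \sum_i \sum_j `|A i j|.

Let N_ge0 : 0 <= N.
Proof. by apply: sumr_ge0 => i _; apply: sumr_ge0. Qed.

Let pow_le k i j : `|pow k i j| <= N ^+ k.
Proof.
elim: k i j => [|k IH] i j; first by rewrite mxE expr0; case: eqP; rewrite ?normr1 ?normr0.
rewrite /pow iterS -/(pow k) mxE exprS; apply: le_trans (ler_norm_sum _ _ _) _.
rewrite {1}/N mulr_suml [leRHS](bigD1 i) //= ler_wpDr //.
  by apply: sumr_ge0 => l _; rewrite mulr_ge0 ?exprn_ge0 // sumr_ge0.
rewrite mulr_suml; apply: ler_sum => l _.
by rewrite normrM ler_wpM2l.
Qed.

(** Comparison with the series of [N ^+ p * expR (N * |t|)]. *)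
Let coef_cvg p i j t : cvgn (pseries (coef p i j) t).
Proof.
apply: normed_cvg.
apply: (@series_le_cvg _ _ (fun k => N ^+ p * exp_coeff (N * `|t|) k)).
- by move=> k; exact: normr_ge0.
- by move=> k; rewrite mulr_ge0 ?exprn_ge0 // exp_coeff_ge0 // mulr_ge0.
- move=> k; rewrite /exp_coeff /coef /= !normrM normfV normrX normr_nat.
  rewrite exprMn !mulrA -exprD addnC mulrAC.
  by rewrite ler_wpM2r ?invr_ge0 ?ler0n // ler_wpM2r ?exprn_ge0.
- rewrite (_ : (fun k => _) = N ^+ p *: exp_coeff (N * `|t|)); last exact/funext.
  by apply: is_cvg_seriesZ; exact: is_cvg_series_exp_coeff.
Qed.

Let coef_diffs p i j : pseries_diffs (coef p i j) = coef p.+1 i j.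
Proof.
apply/funext => k; rewrite /pseries_diffs /coef addSnnS factS natrM invfM.
by rewrite mulrCA mulVKf ?pnatr_eq0.
Qed.

Definition expmx (t : R) : 'M[R]_n := \matrix_(i, j) limn (pseries (coef 0 i j) t).

Let coefS_lim i j t :
  limn (pseries (coef 1 i j) t) = \sum_l A i l * limn (pseries (coef 0 l j) t).
Proof.
apply: cvg_lim => //.
have -> : pseries (coef 1 i j) t = fun m => \sum_l A i l * pseries (coef 0 l j) t m.
  apply/funext => m; rewrite /pseries /series /=.
  under [RHS]eq_bigr do rewrite mulr_sumr.
  rewrite exchange_big /=; apply: eq_bigr => k _.
  rewrite /coef addn1 addn0 /pow iterS mxE -/(pow k) !mulr_suml.
  by apply: eq_bigr => l _; rewrite !mulrA.
have -> : (fun m => \sum_l A i l * pseries (coef 0 l j) t m) =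
    \sum_l (A i l *: pseries (coef 0 l j) t).
  by apply/funext => m; rewrite fct_sumE.
elim/big_ind2 : _ => [|f a g b hf hg|l _]; first exact: cvg_cst.
  exact: cvgD.
apply: cvgZl_tmp; exact: coef_cvg.
Qed.

Lemma expmx0 : expmx 0 = 1%:M.
Proof.
apply/matrixP => i j; rewrite mxE; apply: lim_near_cst => //.
exists 1%N => // -[//|m] _; rewrite /pseries /series /= big_nat_recl // big1 => [|k _].
  by rewrite addr0 expr0 mulr1 /coef addn0 fact0 divr1.
by rewrite expr0n mulr0.
Qed.

Lemma is_derive_expmx_entry i j t :
  is_derive t (1 : R) (fun s => expmx s i j) ((A *m expmx t) i j).
Proof.
have -> : (fun s => expmx s i j) = (fun s => limn (pseries (coef 0 i j) s)).
  by apply/funext => s; rewrite mxE.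
have -> : (A *m expmx t) i j = limn (pseries (pseries_diffs (coef 0 i j)) t).
  by rewrite coef_diffs coefS_lim mxE; apply: eq_bigr => l _; rewrite mxE.
(* Termwise differentiation needs convergence at a point of modulus larger than that of [t]. *)
apply: (@pseries_snd_diffs _ _ (`|t| + 1)); rewrite ?coef_diffs; try exact: coef_cvg.
by rewrite [ltRHS]ger0_norm ?addr_ge0 // ltrDl.
Qed.

End MatrixExponential.

Lemma is_derive_mxP (R : realType) (m n : nat) (M : R -> 'M[R]_(m, n)) (dM : 'M[R]_(m, n)) (t : R) :
  is_derive t (1 : R) M dM <->
  forall i j, is_derive t (1 : R) (fun s => M s i j) (dM i j).
Proof.
split=> h.
  have d : derivable M t 1 by exact: ex_derive.
  move=> i j; have dij := (derivable_mxP M t 1).1 d i j.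
  apply: DeriveDef => //.
  by have := derive_mx d; rewrite derive_val => ->; rewrite mxE.
have d : derivable M t 1 by apply/derivable_mxP => i j; exact: ex_derive.
apply: DeriveDef => //; rewrite derive_mx //; apply/matrixP => i j.
by rewrite mxE derive_val.
Qed.

Lemma is_derive_expmx (R : realType) (n : nat) (A : 'M[R]_n) (t t0 : R) :
  is_derive t (1 : R) (fun s => expmx A (s - t0)) (A *m expmx A (t - t0)).
Proof.
apply/is_derive_mxP => i j.
have hs : is_derive t (1 : R) (fun s => s - t0) 1.
  have := is_deriveB (is_derive_id t (1 : R)) (is_derive_cst t0 t (1 : R)).
  by rewrite subr0.
have := @is_derive1_comp R (fun s => expmx A s i j) (fun s => s - t0) t _ _
  (is_derive_expmx_entry A i j (t - t0)) hs.
by rewrite mulr1.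
Qed.

Lemma Qplus_CVDDS (R : realType) (n : nat) (hn : (0 < n)%N)
    (a b : \bar R) (A : 'M[R]_n) : Qplus A -> CVDDS a b (fun _ : R => A).
Proof.
move=> QA; exists (fun t t0 => expmx A (t - t0)); split.
  move=> t0 _; split; first by rewrite subrr expmx0.
  by move=> t _; apply: is_derive_expmx.
move=> t0 t _ t0t _ y y0.
have [n1|n1] := leqP n 1.
  (* For [n = 1] the only edge joins the index to itself, so no pattern changes. *)
  apply: sc_plus_le => // e _; rewrite (_ : cyclic_changes n e = 0%N) //.
  rewrite /cyclic_changes; have -> : n = 1%N by lia.
  by rewrite /changes big_nat1 !modn1 addbb.
pose x s := expmx A (s - t0) *m y.
have x0 : x t0 = y by rewrite /x subrr expmx0 mul1mx.
suff xs s : solves A x s.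
  by have := cyclic_changes_decay n1 QA xs t0t; rewrite x0; apply.
move=> i; rewrite /x.
have -> : (fun s => (expmx A (s - t0) *m y) i 0) =
    (fun s => \sum_j y j 0 * expmx A (s - t0) i j).
  by apply/funext => u; rewrite mxE; apply: eq_bigr => j _; rewrite mulrC.
have -> : (A *m (expmx A (s - t0) *m y)) i 0 =
    \sum_j y j 0 * (A *m expmx A (s - t0)) i j.
  by rewrite mulmxA mxE; apply: eq_bigr => j _; rewrite mulrC.
apply: is_derive_bigsum => j; apply: is_derive_mull.
exact: ((is_derive_mxP _ _ _).1 (is_derive_expmx A s t0) i j).
Qed.

(** * Necessity *)

Lemma changes_gt0 e a b : (a <= b)%N -> e a != e b -> (0 < changes e a b)%N.
Proof.
move=> ab h; have := odd_changes e ab; rewrite (_ : e a (+) e b = true).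
  by case: (changes e a b).
by move: h; case: (e a); case: (e b).
Qed.

Lemma cyclic_changes_eq0 n e i j : cyclic_changes n e = 0%N ->
  (i < n)%N -> (j < n)%N -> e i = e j.
Proof.
suff h k : cyclic_changes n e = 0%N -> (k < n)%N -> e k = e (0 %% n)%N.
  by move=> c hi hj; rewrite !h.
move=> c kn; move: c; rewrite /cyclic_changes (@changes_cat _ 0 k) // 1?ltnW //.
move=> /eqP; rewrite addn_eq0 => /andP[/eqP c _].
have := odd_changes (fun k => e (k %% n)%N) (leq0n k); rewrite c /= (modn_small kn).
by case: (e k); case: (e _).
Qed.

Section RightDerivative.
Local Open Scope classical_set_scope.
Variable R : realType.

Lemma right_derivative_pos (f : R -> R) (t df : R) : is_derive t (1 : R) f df -> 0 < df ->
  \forall s \near t^'+, f t < f s.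
Proof.
move=> fd df0; have fD : derivable f t 1 by exact: ex_derive.
have : h^-1 *: ((f \o shift t) (h *: 1) - f t) @[h --> 0^'] --> df.
  have <- : 'D_1 f t = df by exact: derive_val.
  exact: fD.
move=> /cvgr_gt /(_ _ df0) /nbhs_ballP[d /= d0 hd].
near=> s.
have ts : t < s by near: s; exact: nbhs_right_gt.
have sd : s < t + d by near: s; apply: nbhs_right_lt; rewrite ltrDl.
have := hd (s - t); rewrite /ball /= sub0r normrN gtr0_norm ?subr_gt0 //.
rewrite ltrBlDl => /(_ sd); rewrite subr_eq0 gt_eqF // => /(_ isT).
rewrite /GRing.scale /= mulr1 subrK pmulr_rgt0 ?invr_gt0 ?subr_gt0 //.
Unshelve. all: by end_near. Qed.

Lemma near_right_both (P Q : R -> Prop) (t : R) :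
  (\forall s \near t^'+, P s) -> (\forall s \near t^'+, Q s) ->
  exists s, P s /\ Q s.
Proof.
move=> hP hQ; apply: (@filter_ex _ (t^'+) _ [set s | P s /\ Q s]).
exact: filterI.
Qed.

Lemma right_derivative_ge0 (f : R -> R) (t df : R) : is_derive t (1 : R) f df ->
  (\forall s \near t^'+, f t <= f s) -> 0 <= df.
Proof.
move=> fd h; rewrite leNgt; apply/negP => df0.
have gd : is_derive t (1 : R) (fun s => - f s) (- df) by exact: is_deriveN.
have := right_derivative_pos gd; rewrite oppr_gt0 => /(_ df0) h'.
have [s [h1]] := near_right_both h h'.
by rewrite ltrN2 => /(le_lt_trans h1); rewrite ltxx.
Qed.

Lemma is_derive_near_right_gt (f : R -> R) (t df c : R) : is_derive t (1 : R) f df ->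
  c < f t -> \forall s \near t^'+, c < f s.
Proof.
move=> fd cf; have fc : {for t, continuous f}.
  by apply: differentiable_continuous; apply/derivable1_diffP; exact: ex_derive.
exact: (cvgr_gt (f t) (cvg_at_right_filter fc)).
Qed.

Lemma ereal_interval_ex (a b : \bar R) : (a < b)%E ->
  exists t0 t1 : R, [/\ (a < t0%:E)%E, t0 < t1 & (t1%:E < b)%E].
Proof.
case: a b => [r| |] [s| |] //=; rewrite ?lte_fin => h.
- by exists ((2 * r + s) / 3), ((r + 2 * s) / 3); rewrite !lte_fin; split; lra.
- by exists (r + 1), (r + 2); rewrite lte_fin ltry; split => //; lra.
- by exists (s - 2), (s - 1); rewrite lte_fin ltNyr; split => //; lra.
- by exists 0, 1; rewrite ltNyr ltry; split.
Qed.

End RightDerivative.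

(** * Properties of the generator forced by the SCVDP of the flow *)

Section Necessity.
Local Open Scope classical_set_scope.
Variables (R : realType) (n : nat) (A : 'M[R]_n) (F : R -> 'M[R]_n) (t0 t1 : R).
Hypothesis n_gt1 : (1 < n)%N.
Hypothesis t01 : t0 < t1.
Hypothesis F0 : F t0 = 1%:M.
Hypothesis dF : forall t, t0 <= t <= t1 -> is_derive t (1 : R) F (A *m F t).
Hypothesis SF : forall t, t0 < t <= t1 -> SCVDP (F t).

Let n_gt0 : (0 < n)%N := ltnW n_gt1.

Let dFij t i j : t0 <= t <= t1 ->
  is_derive t (1 : R) (fun s => F s i j) ((A *m F t) i j).
Proof. by move=> ht; exact: ((is_derive_mxP _ _ _).1 (dF ht) i j). Qed.

Let t00 : t0 <= t0 <= t1. Proof. by rewrite lexx ltW. Qed.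

Let near_t1 : \forall t \near t0^'+, t0 < t <= t1.
Proof.
by near=> t; apply/andP; split; near: t; [exact: nbhs_right_gt|exact: nbhs_right_ltW].
Unshelve. all: by end_near. Qed.

Lemma flow_pos i j : \forall t \near t0^'+, 0 < F t i j.
Proof.
have hjj : \forall t \near t0^'+, 0 < F t j j.
  by apply: (is_derive_near_right_gt (dFij j j t00)); rewrite F0 mxE eqxx.
near=> t.
have tt : t0 < t <= t1 by near: t.
have Fjj : 0 < F t j j by near: t.
pose x : 'cV[R]_n := delta_mx j 0.
have x0 : x != 0.
  by apply/eqP => /matrixP/(_ j 0); rewrite !mxE !eqxx => /eqP; rewrite oner_eq0.
have Fx k : (F t *m x) k 0 = F t k j by rewrite -colE mxE.
have c0 : (sc_plus (cv_seq (F t *m x)) <= 0)%N.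
  apply: leq_trans (SF tt x0) _.
  have hx : sign_compat (fun _ => false) x.
    by move=> k; rewrite expr0 mul1r mxE; case: eqP.
  apply: leq_trans (sc_minus_le n_gt0 hx) _.
  by rewrite /cyclic_changes /changes big1.
(* Zeros are counted as negative: this pattern must be constant and is positive at [j], so every
   entry is strictly positive. *)
pose e k := if insub k is Some i then (F t *m x) (i : 'I_n) 0 <= 0 else false.
have he : sign_compat e (F t *m x).
  move=> k; have -> : e k = ((F t *m x) k 0 <= 0) by rewrite /e valK.
  case: (leP ((F t *m x) k 0) 0) => h; first by rewrite expr1 mulN1r oppr_ge0.
  by rewrite expr0 mul1r ltW.
have := leq_trans (sc_plus_ge n_gt0 he) c0; rewrite leqn0 => /eqP ce.
have := cyclic_changes_eq0 ce (ltn_ord i) (ltn_ord j).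
by rewrite /e !valK !Fx [F t j j <= 0]leNgt Fjj /= ltNge => ->.
Unshelve. all: by end_near. Qed.

Lemma generator_metzler : metzler A.
Proof.
move=> i j ij; have := dFij i j t00; rewrite F0 mulmx1 => d.
apply: (right_derivative_ge0 d); rewrite F0 mxE (negbTE ij).
by apply: filterS (flow_pos i j) => t /ltW.
Qed.

(** If [j] is not reachable from [i], the part of column [j] of the flow on the indices reachable
    from [i] solves a closed system with zero initial value. It stays zero, against [flow_pos]. *)
Lemma generator_irreducible : irreducible_mx A.
Proof.
move=> i j; apply: contraT => nij.
pose S := connect [rel k l | A k l != 0] i.
have closed k l : S k -> ~~ S l -> A k l = 0.
  move=> Sk; apply: contraNeq => Akl; apply: connect_trans Sk _; exact: connect1.
pose A' : 'M[R]_n := \matrix_(k, l) if S k && S l then A k l else 0.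
pose x t : 'cV[R]_n := \col_k if S k then F t k j else 0.
have xs t : t0 <= t <= t1 -> solves A' x t.
  move=> ht k; have [Sk|Sk] := boolP (S k).
    have -> : (fun s => x s k 0) = (fun s => F s k j) by apply/funext => s; rewrite mxE Sk.
    have -> : (A' *m x t) k 0 = (A *m F t) k j; last exact: dFij.
    rewrite !mxE; apply: eq_bigr => l _; rewrite !mxE Sk /=.
    by case: ifPn => // Sl; rewrite closed // !mul0r.
  have -> : (fun s => x s k 0) = cst 0 by apply/funext => s; rewrite mxE (negbTE Sk).
  have -> : (A' *m x t) k 0 = 0; last exact: is_derive_cst.
  by rewrite mxE big1 // => l _; rewrite mxE (negbTE Sk) mul0r.
have x0 : x t0 = 0.
  apply/matrixP => k l; rewrite !mxE F0 mxE; case: ifP => // Sk.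
  by case: eqP => // kj; move: nij; rewrite -kj -/(S k) Sk.
have [t [/andP[tt tt1] Fij]] := near_right_both near_t1 (flow_pos i j).
have /matrixP/(_ i 0) : x t = 0.
  apply: (gronwall_zero tt _).1 x0 => s /andP[s0 st]; apply: xs.
  by rewrite s0 (le_trans st).
by rewrite !mxE /S connect0 => e; rewrite e ltxx in Fij.
Qed.

Lemma nonadjacent_changes (i j : 'I_n) :
  ~ [\/ i = j, (j = i.+1 :> nat) \/ (i = j.+1 :> nat),
        (i = 0 :> nat) /\ (j = n.-1 :> nat) | (i = n.-1 :> nat) /\ (j = 0 :> nat)] ->
  (4 <= cyclic_changes n (fun k => (k != i) && (k != j)))%N.
Proof.
move=> nadj; have := ltn_ord i; have := ltn_ord j => jn hin.
(* The lift of [i] to the window from [j] to [j + n]; non-adjacency leaves an index on either side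
   between it and the ends. *)
pose i' := if (j < i)%N then nat_of_ord i else (i + n)%N.
have ij : (i : nat) != j by apply/eqP => /val_inj h; apply: nadj; constructor 1.
have [h1 h2] : (j.+1 < i')%N /\ (i'.+1 < j + n)%N.
  have d1 : (j : nat) <> i.+1 by move=> h; apply: nadj; constructor 2; left.
  have d2 : (i : nat) <> j.+1 by move=> h; apply: nadj; constructor 2; right.
  have d3 : (i : nat) = 0%N -> (j : nat) <> n.-1 by move=> h h'; apply: nadj; constructor 3.
  have d4 : (i : nat) = n.-1 -> (j : nat) <> 0%N by move=> h h'; apply: nadj; constructor 4.
  rewrite /i'; move: (nat_of_ord i) (nat_of_ord j) hin jn ij d1 d2 d3 d4 => p q.
  by clear; case: (ltnP q p) => h; lia.
have ci' : cyc n_gt1 i' = i.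
  by rewrite /i'; case: ifP => _; rewrite ?cycD cyc_val.
rewrite -(cyclic_changes_shift n _ j).
set f := fun k => _.
have fE k : f k = (cyc n_gt1 k != i) && (cyc n_gt1 k != j) by [].
have fj : f j = false by rewrite fE cyc_val eqxx andbF.
have fjn : f (j + n)%N = false by rewrite fE cycD cyc_val eqxx andbF.
have fi : f i' = false by rewrite fE ci' eqxx.
have fj1 : f j.+1 = true.
  rewrite fE; apply/andP; split; first by rewrite -[X in _ != X]ci'; apply: cyc_eq; lia.
  by rewrite eq_sym -[X in X != _](cyc_val n_gt1 j); apply: cyc_eq; lia.
have fi1 : f i'.+1 = true.
  rewrite fE; apply/andP; split.
    by rewrite eq_sym -[X in X != _]ci'; apply: cyc_eq; lia.
  by rewrite -[X in _ != X](cyc_val n_gt1 j) -[X in _ != X]cycD; apply: cyc_eq; lia.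
have -> : changes f j (j + n) = (changes f j j.+1 + (changes f j.+1 i' +
    (changes f i' i'.+1 + changes f i'.+1 (j + n))))%N.
  by rewrite -!changes_cat //; lia.
have q1 : (0 < changes f j j.+1)%N by apply: changes_gt0 => //; rewrite fj fj1.
have q2 : (0 < changes f j.+1 i')%N by apply: changes_gt0; rewrite ?fi ?fj1 // ltnW.
have q3 : (0 < changes f i' i'.+1)%N by apply: changes_gt0 => //; rewrite fi fi1.
have q4 : (0 < changes f i'.+1 (j + n))%N by apply: changes_gt0; rewrite ?fi1 ?fjn // ltnW.
lia.
Qed.

(** Only the two edges at [j] can carry a change. *)
Lemma single_changes (j : 'I_n) : (cyclic_changes n (fun k => k != j) <= 2)%N.
Proof.
rewrite -(cyclic_changes_shift n _ j); set f := fun k => _.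
have ft k : (j < k)%N -> (k < j + n)%N -> f k = true.
  move=> jk kn; rewrite /f -[_ != _]/(cyc n_gt1 k != j) eq_sym.
  by rewrite -[X in X != _](cyc_val n_gt1 j) cyc_eq.
have -> : changes f j (j + n) =
    (changes f j j.+1 + (changes f j.+1 (j + n.-1) + changes f (j + n.-1) (j + n)))%N.
  by rewrite -!changes_cat //; lia.
have -> : changes f j.+1 (j + n.-1) = 0%N.
  rewrite /changes big_nat_cond big1 // => k; rewrite andbT => /andP[k1 k2].
  by rewrite !ft //; lia.
rewrite (_ : (j + n)%N = (j + n.-1).+1); last by lia.
by rewrite /changes !big_nat1; do 2 case: addb.
Qed.

Lemma generator_cyclic_tridiagonal : cyclic_tridiagonal A.
Proof.
move=> i j Aij; apply: contrapT => nadj.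
have ij : i != j by apply/eqP => h; apply: nadj; constructor 1.
have Aij0 : 0 < A i j by rewrite lt_neqAle eq_sym Aij generator_metzler.
(* With this [M] the term of [j] in [(A *m x) i 0] exceeds by 1 all that the entries -1 can
   subtract. *)
pose M := (\sum_k `|A i k| + 1) / A i j.
have M0 : 0 < M by rewrite divr_gt0 // ltr_wpDl // sumr_ge0.
pose x : 'cV[R]_n := \col_k if k == i then 0 else if k == j then M else -1.
have x0 : x != 0.
  apply/eqP => /matrixP/(_ j 0); rewrite !mxE eqxx eq_sym (negbTE ij) => h.
  by rewrite h ltxx in M0.
have Ax : 0 < (A *m x) i 0.
  rewrite mxE (bigD1 j) //= mxE eq_sym (negbTE ij) eqxx /M mulrC divfK //.
  rewrite [X in _ < X + _]addrC -addrA ltr_wpDr // (bigD1 j) //= -addrA addr_ge0 //.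
  rewrite -big_split /=; apply: sumr_ge0 => k kj; rewrite mxE (negbTE kj).
  case: eqP => _; first by rewrite mulr0 addr0.
  by rewrite mulrN1 subr_ge0 ler_norm.
have yd k : is_derive t0 (1 : R) (fun s => (F s *m x) k 0) ((A *m x) k 0).
  have -> : (fun s => (F s *m x) k 0) = (fun s => \sum_l x l 0 * F s k l).
    by apply/funext => u; rewrite mxE; apply: eq_bigr => l _; rewrite mulrC.
  have -> : (A *m x) k 0 = \sum_l x l 0 * (A *m F t0) k l.
    by rewrite F0 mulmx1 mxE; apply: eq_bigr => l _; rewrite mulrC.
  exact: (is_derive_bigsum (fun l => is_derive_mull (x l 0) (dFij k l t00))).
pose e k := (k != i :> nat) && (k != j :> nat).
(* At [i] the entry leaves 0 with positive derivative; elsewhere the nonzero initial sign persists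
   by continuity. *)
have he : \forall t \near t0^'+, forall k : 'I_n, 0 < (-1) ^+ e k * (F t *m x) k 0.
  apply: filter_forall => k.
  have [->|ki] := eqVneq k i.
    have := right_derivative_pos (yd i) Ax; rewrite F0 mul1mx mxE eqxx.
    by apply: filterS => t; rewrite /e eqxx expr0 mul1r.
  have := is_derive_mull ((-1) ^+ e k) (yd k) => d.
  apply: (is_derive_near_right_gt d); rewrite F0 mul1mx mxE (negbTE ki) /e.
  have -> : (k != i :> nat) by [].
  have [->|kj] := eqVneq k j; first by rewrite eqxx expr0 mul1r.
  by have -> : (k != j :> nat); rewrite // expr1 mulrNN mulr1 ltr01.
have [t [tt hpos]] := near_right_both near_t1 he.
have c1 : sign_compat e (F t *m x) by move=> k; exact/ltW/hpos.
(* The zero of [x] at [i] may be counted as negative, which leaves only the changes around [j]. *)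
have c2 : sign_compat (fun k => k != j) x.
  move=> k; rewrite mxE; have [->|ki] := eqVneq k i; first by rewrite mulr0.
  have [->|kj] := eqVneq k j; first by rewrite eqxx expr0 mul1r ltW.
  by have -> : (k != j :> nat); rewrite // expr1 mulrNN mulr1 ler01.
have := leq_trans (nonadjacent_changes nadj) (sc_plus_ge n_gt0 c1).
move=> /leq_trans/(_ (SF tt x0))/leq_trans/(_ (sc_minus_le n_gt0 c2)).
by move=> /leq_trans/(_ (single_changes j)).
Qed.

End Necessity.

Lemma CVDDS_Qplus (R : realType) (n : nat) (a b : \bar R) (A : 'M[R]_n) :
  (a < b)%E -> CVDDS a b (fun _ : R => A) -> Qplus A.
Proof.
move=> hab [Phi [hPhi hS]].
have [n1|n1] := leqP n 1.
  (* With at most one index, all three conditions are immediate. *)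
  have eqI (i j : 'I_n) : i = j.
    by apply: val_inj => /=; have := ltn_ord i; have := ltn_ord j; lia.
  split=> [i j|i j|i j _]; first by rewrite (eqI i j) eqxx.
    by rewrite (eqI i j) connect0.
  by constructor 1.
have [t0 [t1 [at0 t01 t1b]]] := ereal_interval_ex hab.
have inab t : t0 <= t <= t1 -> (a < t%:E < b)%E.
  move=> /andP[h1 h2]; rewrite (lt_le_trans at0) ?lee_fin //=.
  by rewrite (le_lt_trans _ t1b) // lee_fin.
have t00 : t0 <= t0 <= t1 by rewrite lexx ltW.
have [F0 dF] := hPhi t0 (inab t0 t00).
have dF' t : t0 <= t <= t1 -> is_derive t (1 : R) (fun s => Phi s t0) (A *m Phi t t0).
  by move=> /inab; exact: dF.
have SF t : t0 < t <= t1 -> SCVDP (Phi t t0).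
  move=> /andP[h1 h2]; apply: hS => //.
  by rewrite (le_lt_trans _ t1b) // lee_fin.
split.
- exact: (generator_metzler n1 t01 F0 dF' SF).
- exact: (generator_irreducible n1 t01 F0 dF' SF).
- exact: (generator_cyclic_tridiagonal n1 t01 F0 dF' SF).
Qed.

Theorem theorem5 (R : realType) (n : nat) (hn : (0 < n)%N)
    (a b : \bar R) (hab : (a < b)%E) (A : 'M[R]_n) :
  CVDDS a b (fun _ : R => A) <-> Qplus A.
Proof. by split; [exact: CVDDS_Qplus|exact: Qplus_CVDDS]. Qed.
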